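(* There exist a Banach space $X$ (which can even be taken to be a Hilbert space) and a continuous linear operator $T:X\longrightarrow X$ (which can even be taken, on such a Hilbert space, to be invertible) such that the restriction of $T$ to its closed $T$-invariant subspace of chain recurrent vectors, $T\vert_{CR(T)}:CR(T)\longrightarrow CR(T)$, is not a chain recurrent operator. In particular, the operator $T$ can be constructed so that the subspace $CR(T)$ is infinite-dimensional while its restriction satisfies $CR(T\vert_{CR(T)})=\{0_X\}$, where $0_X\in X$ is the zero-vector.
   Context: Banach and Hilbert spaces are over $\mathbb{K}=\mathbb{R}$ or $\mathbb{C}$. Let $T:X\to X$ be a continuous linear operator on a Banach space $(X,\|\cdot\|)$. Given $\delta>0$, a finite sequence $(f_l)_{l=0}^m$ in $X$, with $m\in\mathbb{N}=\{1,2,\dots\}$, is a $\delta$-chain for $T$ from $f_0$ to $f_m$ if $\|f_l-T(f_{l-1})\|<\delta$ for every $1\leq l\leq m$. A vector $f\in X$ is chain recurrent for $T$ if for every $\delta>0$ there exists a $\delta$-chain for $T$ from $f$ to itself. $CR(T)$ denotes the set of chain recurrent vectors for $T$; it is always a closed $T$-invariant linear subspace of $X$, so $T\vert_{CR(T)}$ is a continuous linear operator on the Banach space $CR(T)$ (with the norm of $X$), and $CR(T\vert_{CR(T)})$ is its own set of chain recurrent vectors (all chains being contained in $CR(T)$). An operator $T$ is chain recurrent if $CR(T)=X$. Invertible means bijective with continuous inverse. *)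

(* Defs.v *)
From HB Require Import structures.
From mathcomp Require Import all_boot all_order all_algebra.
From mathcomp Require Import sesquilinear complex.
From mathcomp Require Import all_classical all_reals all_analysis.

Set Implicit Arguments.
Unset Strict Implicit.
Unset Printing Implicit Defensive.

Import Order.TTheory GRing.Theory Num.Theory.
Import numFieldNormedType.Exports.

Local Open Scope classical_set_scope.
Local Open Scope ring_scope.

(* The pairs (K, conjugation of K) for K the real or the complex numbers. *)
Inductive scalar_field (R : realType) :
    forall K : numFieldType, (K -> K) -> Prop :=
| real_scalars : @scalar_field R R idfun
| complex_scalars : @scalar_field R R[i] (@conjc R).

(* Norms, and hence the bounds [delta] below, are valued in [K]; when [K] is
   [R[i]], [0 < delta] means that [delta] is real and positive. *)

Definition hilbert_norm (K : numFieldType) (conj : K -> K)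
    (X : completeNormedModType K) : Prop :=
  exists dot : {dot X for conj}, forall x : X, `|x| ^+ 2 = dot x x.

Definition invertible_operator (K : numFieldType) (X : normedModType K)
    (T : X -> X) : Prop :=
  exists S : X -> X, [/\ cancel T S, cancel S T & continuous S].

Section ChainRecurrence.
Context {K : numFieldType} {X : normedModType K}.

(* Only the values [c 0], ..., [c m] of the sequence [c] matter. *)
Definition delta_chain (Y : set X) (T : X -> X) (delta : K) (f g : X)
    (m : nat) (c : nat -> X) : Prop :=
  [/\ (0 < m)%N, c 0%N = f, c m = g,
      forall l, (l <= m)%N -> Y (c l)
    & forall l, (1 <= l <= m)%N -> `|c l - T (c l.-1)| < delta].

(* For a [T]-invariant subspace [Y], [CR_on Y T] is the set of chain recurrent
   vectors of the restriction of [T] to [Y], with the norm of [X]. *)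
Definition CR_on (Y : set X) (T : X -> X) : set X :=
  [set f | forall delta : K, 0 < delta ->
             exists m c, delta_chain Y T delta f f m c].

Definition CR (T : X -> X) : set X := CR_on setT T.

Definition chain_recurrent_on (Y : set X) (T : X -> X) : Prop :=
  CR_on Y T = Y.

Definition finite_dimensional (Y : set X) : Prop :=
  exists (n : nat) (b : 'I_n -> X), (forall i, Y (b i)) /\
    forall y, Y y -> exists a : 'I_n -> K, y = \sum_(i < n) a i *: b i.

End ChainRecurrence.

(* Main.v *)
Require Import Defs.
From HB Require Import structures.
From mathcomp Require Import all_boot all_order all_algebra.
From mathcomp Require Import finmap.
From mathcomp Require Import sesquilinear complex.
From mathcomp Require Import all_classical all_reals all_analysis.
From mathcomp Require Import showcase.summability.
From mathcomp Require Import ring lra.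

Set Implicit Arguments.
Unset Strict Implicit.
Unset Printing Implicit Defensive.

Import Order.TTheory GRing.Theory Num.Theory.
Import numFieldNormedType.Exports.

Local Open Scope classical_set_scope.
Local Open Scope ring_scope.

(** The space is the Hilbert space of square summable families indexed by the
sites (p, r), where p is an integer and the line r is either the main line
[None] or a hump [Some q], with q a natural number.  The operator [fed_shift]
moves each site one step to the right along its line, with a weight:

- on the main line the weight is 2 at every step;
- on the hump q the weight is 4 for the q steps from p = 0 to p = q, and 1/4 at
  all other steps; moreover the site p = q of the hump also feeds, with
  weight 1, the site p = q + 1 of the main line.

Restricted to the vectors carried by the main line, the operator doubles norms.
Such an expansion has no nonzero chain recurrent vector: along a delta-chain
that starts at f, with delta small compared to |f|, the norm stays above |f|
and never returns to it ([CR_on_expansive]).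

In the whole space, on the contrary, the basis vectors of the main line are
chain recurrent.  Small multiples of basis vectors grow along the main line, so
that 0 leads to every basis vector ([main_basis_from0]).  To go from the basis
vector at k to 0 ([main_basis_to0]), add at time 0 the perturbation
-2 2^-m at the site k of the hump q = k + m, which is as small as desired if m
is large.  In m steps the main line part has grown to 2^m and the perturbation,
which grows like 4^j, to -2 2^m; at the next step the hump feeds the main line
and the two cancel.  What remains lies on the decaying part of the hump, and
tends to 0.

Smaller values of delta need longer humps, and no single hump carries a chain
recurrent vector: after multiplication of the coordinates of the hump by
suitable positive weights ([damping]), the operator contracts by 1/4 there, so
that the coordinates of a chain recurrent vector vanish on it
([CR_main_line]).  Hence CR(T) consists of vectors of the main line, on which T
expands, and it contains all basis vectors at k >= 0 of the main line.

Finally T = shift o (1 + feed), where [shift] is an invertible weighted shift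
and [feed] has square 0, so T is invertible with inverse
(1 - feed) o shift^-1.

Real and complex scalars are treated together, through the properties gathered
in [hilbert_scalars]. *)

#[local] Existing Instance totally_filter.

(** * Real and complex scalars *)

(** What the construction of a Hilbert space uses of the scalars.  Norms take
values in K, but suprema and square roots are taken in R; [real_in] and [absr]
go back and forth between the two. *)
Record hilbert_scalars (R : realType) (K : numFieldType) (conj : K -> K) :=
  HilbertScalars {
    real_in : {rmorphism R -> K};
    absr : K -> R;
    ler_real_in : forall x y, (real_in x <= real_in y) = (x <= y);
    normE : forall x, `|x| = real_in (absr x);
    conjD : {morph conj : x y / x + y};
    conjM : {morph conj : x y / x * y};
    conj_invol : involutive conj;
    mul_conj : forall x, x * conj x = `|x| ^+ 2;
    scalar_complete : forall F : set_system K,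
      ProperFilter F -> cauchy F -> cvg F }.

Section RealScalars.
Variable R : realType.

Lemma real_mul_conj (x : R) : x * idfun x = `|x| ^+ 2.
Proof. by rewrite real_normK ?num_real. Qed.

Definition real_hilbert_scalars : @hilbert_scalars R R idfun.
Proof.
exists (idfun : {rmorphism R -> R}) (fun x => `|x|) => //.
  exact: real_mul_conj.
exact: R_complete.
Defined.
End RealScalars.

Section ComplexScalars.
Variable R : realType.
Local Notation C := (R[i] : numFieldType).
Local Notation Re := (@complex.Re R).
Local Notation Im := (@complex.Im R).

Lemma ler_norm_Re (x : C) : (`|Re x|)%:C%C <= `|x|.
Proof. exact: normc_ge_Re. Qed.

Lemma ler_norm_Im (x : C) : (`|Im x|)%:C%C <= `|x|.
Proof.
rewrite normc_def lecR -sqrtr_sqr ler_sqrt ?addr_ge0 ?sqr_ge0//.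
by rewrite lerDr sqr_ge0.
Qed.

Lemma ler_norm_ReIm (x : C) : `|x| <= (`|Re x| + `|Im x|)%:C%C.
Proof.
rewrite normc_def lecR -[leRHS]ger0_norm ?addr_ge0// -sqrtr_sqr.
rewrite ler_sqrt ?sqr_ge0// sqrrD !real_normK ?num_real//.
by rewrite lerD2r lerDl mulrn_wge0// mulr_ge0.
Qed.

(** A Cauchy filter on R[i] converges because its images by the real and the
imaginary part are Cauchy filters on R. *)
Lemma complex_complete (F : set_system C) :
  ProperFilter F -> cauchy F -> cvg F.
Proof.
move=> FF /cauchyP Fc.
have part (p : C -> R) : (forall x y, p (x - y) = p x - p y) ->
    (forall x, (`|p x|)%:C%C <= `|x| :> C) -> cvg (p @ F).
  move=> pB pn; apply: R_complete; apply/cauchy_exP => e e0.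
  have e0' : 0 < e%:C%C :> C by rewrite ltcR.
  have [x Fx] := Fc _ e0'.
  exists (p x).
  suff : ball x e%:C%C `<=` p @^-1` ball (p x) e by move/filterS; exact.
  move=> y; rewrite -!ball_normE /= -pB => xy.
  by rewrite -ltcR; exact: le_lt_trans (pn _) xy.
have /cvg_ex[a Fa] := part Re (fun x y => raddfB Re x y) ler_norm_Re.
have /cvg_ex[b Fb] := part Im (fun x y => raddfB Im x y) ler_norm_Im.
apply/cvg_ex; exists (a +i* b)%C; apply/cvgrPdist_lt => e e0.
have er : e = (Re e)%:C%C by rewrite RRe_real ?gtr0_real.
have re0 : 0 < Re e by rewrite -ltcR -er.
move/cvgrPdist_lt: Fa => /(_ (Re e / 2)) /(_ (divr_gt0 re0 (ltr0Sn _ 1))) Fa.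
move/cvgrPdist_lt: Fb => /(_ (Re e / 2)) /(_ (divr_gt0 re0 (ltr0Sn _ 1))) Fb.
rewrite er; near=> x.
apply: le_lt_trans (ler_norm_ReIm _) _; rewrite ltcR [ltRHS]splitr.
rewrite (raddfB Re) (raddfB Im)/=.
by apply: ltrD; near: x.
Unshelve. all: by end_near. Qed.

Definition complex_hilbert_scalars : @hilbert_scalars R C (@conjc R).
Proof.
exists (real_complex R : {rmorphism R -> R[i]})
  (fun x => Num.sqrt (Re x ^+ 2 + Im x ^+ 2)) => //.
- exact: lecR.
- exact: normc_def.
- exact: rmorphD.
- exact: rmorphM.
- exact: conjcK.
- by move=> x; rewrite sqr_normc.
- exact: complex_complete.
Defined.
End ComplexScalars.

Lemma hilbert_scalars_of (R : realType) (K : numFieldType) (conj : K -> K) :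
  scalar_field R conj -> inhabited (hilbert_scalars R conj).
Proof.
case; constructor.
  exact: real_hilbert_scalars.
exact: complex_hilbert_scalars.
Qed.

(** * The real-valued modulus and absolutely summable families *)

Section Modulus.
Context {R : realType} {K : numFieldType} {conj : K -> K}.
Variable S : hilbert_scalars R conj.

Lemma real_in_inj : injective (real_in S).
Proof. by move=> x y /eqP; rewrite eq_le !ler_real_in -eq_le => /eqP. Qed.

Lemma ltr_real_in x y : (real_in S x < real_in S y) = (x < y).
Proof. by rewrite !lt_def ler_real_in (inj_eq real_in_inj). Qed.

Lemma real_in_ge0 x : (0 <= real_in S x) = (0 <= x).
Proof. by rewrite -(ler_real_in S) rmorph0. Qed.

Lemma real_in_gt0 x : (0 < real_in S x) = (0 < x).
Proof. by rewrite -ltr_real_in rmorph0. Qed.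

Lemma absr_ge0 x : 0 <= absr S x.
Proof. by rewrite -real_in_ge0 -normE. Qed.

Lemma absrM x y : absr S (x * y) = absr S x * absr S y.
Proof. by apply: real_in_inj; rewrite rmorphM -!normE normrM. Qed.

Lemma absrN x : absr S (- x) = absr S x.
Proof. by apply: real_in_inj; rewrite -!normE normrN. Qed.

Lemma absr0 : absr S 0 = 0.
Proof. by apply: real_in_inj; rewrite -normE normr0 rmorph0. Qed.

Lemma absr0_eq0 x : absr S x = 0 -> x = 0.
Proof. by move=> x0; apply/eqP; rewrite -normr_eq0 (normE S) x0 rmorph0. Qed.

Lemma ler_absrD x y : absr S (x + y) <= absr S x + absr S y.
Proof. by rewrite -(ler_real_in S) rmorphD -!normE ler_normD. Qed.

Lemma absr_real_in x : 0 <= x -> absr S (real_in S x) = x.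
Proof.
by move=> x0; apply: real_in_inj; rewrite -normE ger0_norm ?real_in_ge0.
Qed.

Lemma real_in_absr x : 0 <= x -> real_in S (absr S x) = x.
Proof. by move=> x0; rewrite -normE ger0_norm. Qed.

Lemma conj0 : conj 0 = 0.
Proof. by apply: (addrI (conj 0)); rewrite -(conjD S) !addr0. Qed.

Lemma conjN x : conj (- x) = - conj x.
Proof. by apply/eqP; rewrite -addr_eq0 -(conjD S) addNr conj0. Qed.

Lemma norm_conj x : `|conj x| = `|x|.
Proof.
have [->|x0] := eqVneq x 0; first by rewrite conj0.
apply: (mulfI (_ : `|x| != 0)); first by rewrite normr_eq0.
by rewrite -normrM (mul_conj S) normrX normr_id expr2.
Qed.

Lemma absr_conj x : absr S (conj x) = absr S x.
Proof. by apply: real_in_inj; rewrite -!normE norm_conj. Qed.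

Lemma conj_cvg (T : Type) (F : set_system T) (FF : Filter F) (u : T -> K) l :
  u x @[x --> F] --> l -> conj (u x) @[x --> F] --> conj l.
Proof.
move=> /cvgrPdist_lt ul; apply/cvgrPdist_lt => e e0.
apply: filterS (ul e e0) => x; congr (_ < _).
by rewrite -norm_conj (conjD S) conjN.
Qed.

(** Positive elements of K come from R, which makes their order
archimedean. *)
Lemma geometric_lt (q : nat) (a e : K) : (1 < q)%N -> 0 <= a -> 0 < e ->
  exists n, a * q%:R^-1 ^+ n < e.
Proof.
move=> q1 a0 e0; rewrite -(real_in_absr a0) -(real_in_absr (ltW e0)).
have e0' : 0 < absr S e by rewrite -real_in_gt0 real_in_absr ?ltW.
have [n an] : exists n, absr S a / absr S e < n%:R.
  exists (Num.bound (absr S a / absr S e)).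
  by rewrite archi_boundP ?divr_ge0 ?absr_ge0.
exists n; have -> : q%:R^-1 = real_in S q%:R^-1 by rewrite fmorphV rmorph_nat.
rewrite -rmorphXn -rmorphM ltr_real_in exprVn.
rewrite ltr_pdivrMr ?exprn_gt0 ?ltr0n ?(ltnW q1)//.
move: an; rewrite ltr_pdivrMr// mulrC => /lt_le_trans; apply.
by rewrite ler_pM2l// -natrX ler_nat ltnW// ltn_expl.
Qed.

(** The finite partial sums form a Cauchy net: beyond a finite set A whose
absolute sum is within e of the supremum, a partial sum moves by less
than e. *)
Lemma absr_summable_cvg (I : choiceType) (u : I -> K) M :
  (forall A : {fset I}, \sum_(i <- A) absr S (u i) <= M) ->
  cvg ((fun A : {fset I} => \sum_(i <- A) u i) @ totally).
Proof.
move=> uM; apply: (scalar_complete S).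
apply: cauchy_exP => e e0.
pose s (A : {fset I}) := \sum_(i <- A) absr S (u i).
have hs : has_sup (range s).
  split; first by exists (s fset0), fset0.
  by exists M => _ [A _ <-]; exact: uM.
have e0' : 0 < absr S e by rewrite -real_in_gt0 real_in_absr ?ltW.
have [_ [A _ <-] sA] := sup_adherent e0' hs.
exists (\sum_(i <- A) u i); exists A => //= B /= AB.
rewrite -ball_normE /= distrC (big_fsetID _ (mem A) B) /=.
have -> : [fset x in B | x \in A]%fset = A.
  by apply/fsetP => x; rewrite !inE /= andb_idl//; exact: (fsubsetP AB).
rewrite addrAC subrr add0r -(real_in_absr (ltW e0)).
rewrite (normE S) ltr_real_in.
apply: (@le_lt_trans _ _ (s B - s A)).
  rewrite /s (big_fsetID _ (mem A) B) /=.
  have -> : [fset x in B | x \in A]%fset = A.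
    by apply/fsetP => x; rewrite !inE /= andb_idl//; exact: (fsubsetP AB).
  rewrite addrAC subrr add0r; elim/big_ind2: _ => //; first by rewrite absr0.
  by move=> ? ? ? ? *; rewrite (le_trans (ler_absrD _ _))// lerD.
rewrite ltrBlDr -ltrBlDl; apply: le_lt_trans sA; rewrite lerD2r.
by apply: ub_le_sup; [case: hs|exists B].
Qed.
End Modulus.

(** * The space of square summable families *)

Section SquareSummable.
Context {R : realType} {K : numFieldType} {conj : K -> K}.
Variables (S : hilbert_scalars R conj) (I : choiceType).
Implicit Types (f g : I -> K) (A : {fset I}).

Definition sqsum f A : R := \sum_(i <- A) absr S (f i) ^+ 2.

Definition square_summable : {pred I -> K} :=
  [pred f | `[< exists M, forall A, sqsum f A <= M >]].

Lemma ler_sqrD (x y : R) : (x + y) ^+ 2 <= 2 * x ^+ 2 + 2 * y ^+ 2.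
Proof. by have := sqr_ge0 (x - y); nra. Qed.

Lemma sqsum_ge0 f A : 0 <= sqsum f A.
Proof. by apply: sumr_ge0 => i _; exact: sqr_ge0. Qed.

Lemma sqsumD f g A : sqsum (f + g) A <= 2 * sqsum f A + 2 * sqsum g A.
Proof.
rewrite /sqsum !mulr_sumr -big_split/=; apply: ler_sum => i _.
apply: le_trans (ler_sqrD _ _).
by rewrite ler_sqr ?nnegrE ?addr_ge0 ?absr_ge0// ler_absrD.
Qed.

Lemma sqsumZ (a : K) f A : sqsum (a *: f) A = absr S a ^+ 2 * sqsum f A.
Proof.
by rewrite /sqsum mulr_sumr; apply: eq_bigr => i _; rewrite absrM exprMn.
Qed.

Lemma square_summable_submod : submod_closed square_summable.
Proof.
split.
  apply/asboolP; exists 0 => A; rewrite /sqsum big1// => i _.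
  by rewrite absr0 expr0n.
move=> a f g /asboolP[M fM] /asboolP[N gN]; apply/asboolP.
exists (2 * (absr S a ^+ 2 * M) + 2 * N) => A.
apply: le_trans (sqsumD _ _ _) _; rewrite sqsumZ.
by rewrite lerD// ler_wpM2l// ler_wpM2l// sqr_ge0.
Qed.

HB.instance Definition _ :=
  GRing.isSubmodClosed.Build K (I -> K) square_summable square_summable_submod.

Record ell2 := Ell2 { ell2_fun :> I -> K; _ : ell2_fun \in square_summable }.

HB.instance Definition _ := [isSub for ell2_fun].
HB.instance Definition _ := [Choice of ell2 by <:].
HB.instance Definition _ := [SubChoice_isSubLmodule of ell2 by <:].

Implicit Types x y z : ell2.

Lemma ell2P x y : (forall i, x i = y i) -> x = y.
Proof. by move=> xy; apply/val_inj/funext. Qed.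

Lemma ell2DE x y i : (x + y) i = x i + y i. Proof. by []. Qed.
Lemma ell2NE x i : (- x) i = - x i. Proof. by []. Qed.
Lemma ell2ZE (a : K) x i : (a *: x) i = a * x i. Proof. by []. Qed.

Definition hnorm x : R := Num.sqrt (sup (range (sqsum x))).

Lemma has_sup_sqsum x : has_sup (range (sqsum x)).
Proof.
split; first by exists (sqsum x fset0), fset0.
by have /asboolP[M fM] := valP x; exists M => _ [A _ <-]; exact: fM.
Qed.

Lemma hnorm_ge0 x : 0 <= hnorm x. Proof. exact: sqrtr_ge0. Qed.

Lemma sqsum_le_sup x A : sqsum x A <= sup (range (sqsum x)).
Proof. by apply: ub_le_sup; [case: (has_sup_sqsum x)|exists A]. Qed.

Lemma sqr_hnorm x : hnorm x ^+ 2 = sup (range (sqsum x)).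
Proof.
by rewrite sqr_sqrtr// (le_trans (sqsum_ge0 x fset0) (sqsum_le_sup _ _)).
Qed.

Lemma sqsum_le_hnorm x A : sqsum x A <= hnorm x ^+ 2.
Proof. by rewrite sqr_hnorm sqsum_le_sup. Qed.

Lemma hnorm_le x c : 0 <= c -> (forall A, sqsum x A <= c ^+ 2) -> hnorm x <= c.
Proof.
move=> c0 xc; rewrite -ler_sqr ?nnegrE ?hnorm_ge0// sqr_hnorm.
by apply: ge_sup => [|_ [A _ <-]]; [case: (has_sup_sqsum x)|exact: xc].
Qed.

Lemma ler_absr_hnorm x i : absr S (x i) <= hnorm x.
Proof.
rewrite -ler_sqr ?nnegrE ?hnorm_ge0 ?absr_ge0//.
by have := sqsum_le_hnorm x [fset i]%fset; rewrite /sqsum big_seq_fset1.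
Qed.

(** With a > |x| and b > |y|, convexity of the square gives
(u + v)^2 <= (a + b) (u^2 / a + v^2 / b); summing over the coordinates yields
|x + y|^2 <= (a + b)^2, with no recourse to the Cauchy-Schwarz inequality. *)
Lemma ler_hnormD x y : hnorm (x + y) <= hnorm x + hnorm y.
Proof.
apply/ler_addgt0Pr => e e0.
have [x0 y0] := (hnorm_ge0 x, hnorm_ge0 y).
pose a := hnorm x + e / 2; pose b := hnorm y + e / 2.
have [a0 b0] : 0 < a /\ 0 < b by rewrite /a /b; split; lra.
have -> : hnorm x + hnorm y + e = a + b by rewrite /a /b; lra.
apply: hnorm_le => [|A]; first by lra.
have xA : sqsum x A <= a ^+ 2.
  apply: le_trans (sqsum_le_hnorm _ _) _.
  by rewrite ler_sqr ?nnegrE// ?ltW// /a; lra.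
have yA : sqsum y A <= b ^+ 2.
  apply: le_trans (sqsum_le_hnorm _ _) _.
  by rewrite ler_sqr ?nnegrE// ?ltW// /b; lra.
apply: (@le_trans _ _ ((a + b) * (sqsum x A / a + sqsum y A / b))).
  rewrite /sqsum !mulr_suml -big_split/= mulr_sumr; apply: ler_sum => i _.
  set u := absr S (x i); set v := absr S (y i).
  apply: (@le_trans _ _ ((u + v) ^+ 2)).
    by rewrite ler_sqr ?nnegrE ?addr_ge0 ?absr_ge0// ler_absrD.
  rewrite -subr_ge0.
  have -> : (a + b) * (u ^+ 2 / a + v ^+ 2 / b) - (u + v) ^+ 2 =
      (b * u - a * v) ^+ 2 / (a * b) by field; rewrite !gt_eqF.
  by rewrite divr_ge0 ?sqr_ge0// mulr_ge0// ltW.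
have ab0 : 0 < a + b by lra.
rewrite expr2 ler_pM2l//.
by apply: lerD; rewrite ler_pdivrMr// -expr2.
Qed.

Lemma ler_hnormZ (a : K) x : hnorm (a *: x) <= absr S a * hnorm x.
Proof.
apply: hnorm_le => [|A]; first by rewrite mulr_ge0 ?absr_ge0 ?hnorm_ge0.
by rewrite (sqsumZ a x A) exprMn ler_wpM2l ?sqr_ge0// sqsum_le_hnorm.
Qed.

Definition ell2_norm x : K := real_in S (hnorm x).

Lemma ell2_normD x y : ell2_norm (x + y) <= ell2_norm x + ell2_norm y.
Proof. by rewrite /ell2_norm -rmorphD ler_real_in ler_hnormD. Qed.

Lemma ell2_normZ (a : K) x : ell2_norm (a *: x) = `|a| * ell2_norm x.
Proof.
rewrite /ell2_norm (normE S) -rmorphM; congr (real_in S _).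
apply/le_anti; rewrite ler_hnormZ/=.
have [->|a0] := eqVneq a 0; first by rewrite absr0 mul0r hnorm_ge0.
have a0' : absr S a != 0 by apply: contra_neq a0; exact: absr0_eq0.
have := ler_hnormZ a^-1 (a *: x); rewrite scalerK//.
move=> /(ler_wpM2l (absr_ge0 S a)).
rewrite mulrA -absrM divff//.
suff -> : absr S 1 = 1 by rewrite mul1r.
by rewrite -[1 in LHS](rmorph1 (real_in S)) absr_real_in.
Qed.

Lemma ell2_norm_eq0 x : ell2_norm x = 0 -> x = 0.
Proof.
rewrite /ell2_norm -(rmorph0 (real_in S)) => /real_in_inj x0.
apply: ell2P => i; apply: (@absr0_eq0 _ _ _ S).
by apply/le_anti; rewrite absr_ge0 -{1}x0 ler_absr_hnorm.
Qed.

HB.instance Definition _ :=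
  Lmodule_isNormed.Build K ell2 ell2_normD ell2_normZ ell2_norm_eq0.

Lemma ell2_normE x : `|x| = real_in S (hnorm x). Proof. by []. Qed.

Lemma ler_norm_coord x i : `|x i| <= `|x|.
Proof. by rewrite (normE S) ell2_normE ler_real_in ler_absr_hnorm. Qed.

End SquareSummable.
Arguments square_summable {R K conj} S I _.

(** * Completeness and inner product *)

Section Completeness.
Context {R : realType} {K : numFieldType} {conj : K -> K}.
Variables (S : hilbert_scalars R conj) (I : choiceType).
Notation ell2 := (ell2 S I).

Lemma near_all_fset (T : Type) (F : set_system T) (FF : Filter F)
    (A : {fset I}) (P : I -> T -> Prop) :
  (forall i, \forall t \near F, P i t) ->
  \forall t \near F, {in A, forall i, P i t}.
Proof.
move=> FP; have : \forall t \near F, forall i : A, P (val i) t.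
  by apply: filter_forall => i; exact: FP.
by apply: filterS => t Pt i iA; exact: (Pt [` iA]%fset).
Qed.

(** A Cauchy filter converges coordinatewise, to some family h.  If all elements
of a set of the filter are within e of x, every finite partial sum of
|x - h|^2 is at most (2 e)^2, because on a finite set of indices h is
arbitrarily close to an element of that set.  So h is square summable and at
distance at most 2 e from x. *)
Lemma ell2_complete (F : set_system ell2) : ProperFilter F -> cauchy F -> cvg F.
Proof.
move=> FF /cauchyP Fc.
have coord i : cvg ((fun x : ell2 => x i) @ F).
  apply: (scalar_complete S); apply: cauchy_exP => e e0.
  have [x Fx] := Fc e e0; exists (x i).
  suff : ball x e `<=` (fun y : ell2 => y i) @^-1` ball (x i) e.
    by move/filterS; exact.
  move=> y; rewrite -!ball_normE /= => xy; apply: le_lt_trans xy.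
  exact: (ler_norm_coord (x - y) i).
pose h i : K := lim ((fun x : ell2 => x i) @ F).
have near_h (x : ell2) (e : R) : 0 < e -> F (ball x (real_in S e)) ->
    forall A, sqsum S (ell2_fun x - h) A <= (2 * e) ^+ 2.
  move=> e0 Fx A; pose n : R := #|` A|%:R.
  have n0 : 0 <= n by rewrite /n ler0n.
  (* The error d on each of n coordinates contributes at most n d^2 <= e^2. *)
  pose d := e / (n + 1).
  have d0 : 0 < d by rewrite divr_gt0// ltr_wpDl.
  have FA : F [set y : ell2 | {in A, forall i, absr S (h i - y i) < d}].
    apply: (@near_all_fset _ F _ A
      (fun i (y : ell2) => absr S (h i - y i) < d)).
    move=> i; have /cvgrPdist_lt := coord i.
    move=> /(_ (real_in S d)); rewrite real_in_gt0 => /(_ d0).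
    by apply: filterS => y /=; rewrite (normE S) ltr_real_in.
  have [y [xy yA]] : exists y, ball x (real_in S e) y /\
      {in A, forall i, absr S (h i - y i) < d}.
    by apply: (@filter_ex _ F); exact: filterI.
  have -> : ell2_fun x - h = (ell2_fun x - ell2_fun y) + (ell2_fun y - h).
    by rewrite addrA subrK.
  apply: le_trans (sqsumD _ _ _ _) _.
  have -> : (2 * e) ^+ 2 = 2 * e ^+ 2 + 2 * e ^+ 2 by ring.
  apply: lerD; rewrite ler_pM2l//.
    apply: le_trans (sqsum_le_hnorm (x - y) A) _.
    rewrite ler_sqr ?nnegrE ?hnorm_ge0 ?(ltW e0)//.
    move: xy; rewrite -ball_normE/= ell2_normE ltr_real_in; exact: ltW.
  apply: (@le_trans _ _ (\sum_(i <- A) d ^+ 2)).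
    rewrite /sqsum !big_seq; apply: ler_sum => i iA.
    rewrite ler_sqr ?nnegrE ?absr_ge0 ?(ltW d0)// -absrN opprB.
    exact/ltW/yA.
  rewrite big_const_seq count_predT iter_addr_0 -mulr_natr -/n /d.
  rewrite expr_div_n mulrAC ler_pdivrMr ?exprn_gt0 ?ltr_wpDl//.
  by rewrite ler_pM2l ?exprn_gt0//; nra.
have hP : h \in square_summable S I.
  have e0 : 0 < real_in S 1 by rewrite real_in_gt0.
  have [x Fx] := Fc _ e0.
  have xh : ell2_fun x - h \in square_summable S I.
    by apply/asboolP; eexists; exact: (near_h x 1).
  have := rpredB (valP x) xh.
  by rewrite opprB addrC subrK.
apply/cvg_ex; exists (Ell2 hP); apply/cvgrPdist_lt => e e0.
pose r := absr S e / 4.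
have r0 : 0 < r by rewrite divr_gt0// -(real_in_gt0 S) real_in_absr ?ltW.
have r0' : 0 < real_in S r by rewrite real_in_gt0.
have [x Fx] := Fc _ r0'.
apply: filterS (Fx) => y; rewrite -ball_normE /= => xy.
rewrite -(subrKA x); apply: le_lt_trans (ler_normD _ _) _.
rewrite -(real_in_absr S (ltW e0)).
have -> : absr S e = 2 * r + 2 * r by rewrite /r; field.
rewrite rmorphD; apply: ler_ltD.
  rewrite distrC ell2_normE ler_real_in; apply: hnorm_le.
    by rewrite mulr_ge0// ltW.
  exact: near_h.
by apply: lt_le_trans xy _; rewrite ler_real_in; lra.
Qed.

HB.instance Definition _ := Uniform_isComplete.Build ell2 ell2_complete.

End Completeness.

Section InnerProduct.
Context {R : realType} {K : numFieldType} {conj : K -> K}.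
Variables (S : hilbert_scalars R conj) (I : choiceType).
Notation ell2 := (ell2 S I).
Implicit Types x y z : ell2.

Definition pairing_sum x y (A : {fset I}) : K := \sum_(i <- A) x i * conj (y i).

Definition inner x y : K := lim (pairing_sum x y @ totally).

Lemma cvg_inner x y : pairing_sum x y @ totally --> inner x y.
Proof.
apply: (@absr_summable_cvg _ _ _ S _ _ (hnorm x ^+ 2 + hnorm y ^+ 2)) => A.
apply: (@le_trans _ _ (sqsum S x A + sqsum S y A)); last first.
  by rewrite lerD ?sqsum_le_hnorm.
rewrite /sqsum -big_split/=; apply: ler_sum => i _; rewrite absrM absr_conj.
by have := sqr_ge0 (absr S (x i) - absr S (y i)); have := absr_ge0 S (x i);
  have := absr_ge0 S (y i); nra.
Qed.

Lemma inner_linear a x y z : inner (a *: x + y) z = a * inner x z + inner y z.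
Proof.
apply/(@cvg_lim _ (@norm_hausdorff _ K)).
have -> : pairing_sum (a *: x + y) z =
    (fun A => a * pairing_sum x z A + pairing_sum y z A).
  apply/funext => A; rewrite /pairing_sum mulr_sumr -big_split/=.
  by apply: eq_bigr => i _; rewrite mulrDl mulrA.
by apply: cvgD; [apply: cvgMr|]; exact: cvg_inner.
Qed.

Lemma inner_conj x y : inner x y = conj (inner y x).
Proof.
apply/(@cvg_lim _ (@norm_hausdorff _ K)).
have -> : pairing_sum x y = conj \o pairing_sum y x.
  apply/funext => A; rewrite /pairing_sum /=.
  elim/big_ind2: _ => [|u u' v v' -> ->|i _]; first by rewrite (conj0 S).
    by rewrite (conjD S).
  by rewrite (conjM S) (conj_invol S) mulrC.
by apply: (conj_cvg S); exact: cvg_inner.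
Qed.

(** The norm was defined by a supremum, the inner product by a limit: the
partial sums of a nonnegative family converge to their supremum. *)
Lemma inner_norm x : `|x| ^+ 2 = inner x x.
Proof.
apply/esym/(@cvg_lim _ (@norm_hausdorff _ K)).
have -> : pairing_sum x x = real_in S \o sqsum S x.
  apply/funext => A; rewrite /pairing_sum /= rmorph_sum; apply: eq_bigr => i _.
  by rewrite (mul_conj S) (normE S) rmorphXn.
rewrite ell2_normE -rmorphXn; apply/cvgrPdist_lt => e e0.
have e0' : 0 < absr S e by rewrite -(real_in_gt0 S) real_in_absr ?ltW.
have [_ [A _ <-] sA] := sup_adherent e0' (has_sup_sqsum x).
exists A => //= B /= AB; rewrite -rmorphB ger0_norm; last first.
  by rewrite real_in_ge0 subr_ge0 sqsum_le_hnorm.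
rewrite -(real_in_absr S (ltW e0)) ltr_real_in ltrBlDr -ltrBlDl sqr_hnorm.
apply: lt_le_trans sA _; rewrite /sqsum [leRHS](big_fsetID _ (mem A) B) /=.
have -> : [fset i in B | i \in A]%fset = A.
  by apply/fsetP => i; rewrite !inE /= andb_idl//; exact: (fsubsetP AB).
by rewrite lerDl sumr_ge0// => i _; exact: sqr_ge0.
Qed.

Lemma inner_zmod_morphl z : zmod_morphism (inner^~ z).
Proof.
by move=> x y; rewrite addrC -scaleN1r inner_linear mulN1r addrC.
Qed.

Lemma inner_zmod_morphr z : zmod_morphism (inner z).
Proof.
by move=> x y; rewrite !(inner_conj z) inner_zmod_morphl (conjD S) (conjN S).
Qed.

Lemma inner_scalel z : scalable_for *%R (inner^~ z).
Proof.
move=> a x; have := inner_linear a x 0 z; rewrite addr0 => ->.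
by have := inner_zmod_morphl z 0 0; rewrite !subrr => ->; rewrite addr0.
Qed.

Lemma inner_scaler z : scalable_for (conj \; *%R) (inner z).
Proof. by move=> a x; rewrite !(inner_conj z) inner_scalel (conjM S). Qed.

Lemma inner_herm x y : inner x y = (-1) ^+ false * conj (inner y x).
Proof. by rewrite expr0 mul1r; exact: inner_conj. Qed.

Lemma inner_pos x : x != 0 -> 0 < inner x x.
Proof. by move=> x0; rewrite -inner_norm exprn_gt0// normr_gt0. Qed.

HB.instance Definition _ := @isBilinear.Build K ell2 ell2 K *%R (conj \; *%R)
  inner inner_zmod_morphl inner_zmod_morphr inner_scalel inner_scaler.
HB.instance Definition _ :=
  @isHermitianSesquilinear.Build K ell2 false conj inner inner_herm.
HB.instance Definition _ := @isDotProduct.Build K ell2 inner inner_pos.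

Lemma ell2_hilbert : hilbert_norm conj ell2.
Proof. by exists inner; exact: inner_norm. Qed.

End InnerProduct.

(** * Weighted composition operators *)

(** The data of the operator x |-> (i |-> weight i * x (source i)).  It is
bounded because injectivity of [source] makes each coordinate of x occur at most
once. *)
Record weighted_map (K : numFieldType) (I : choiceType) := WeightedMap {
  weight : I -> K;
  source : I -> I;
  weight_bound : K;
  source_inj : injective source;
  weight_le : forall i, `|weight i| <= weight_bound }.

Section WeightedMaps.
Context {R : realType} {K : numFieldType} {conj : K -> K}.
Variables (S : hilbert_scalars R conj) (I : choiceType).
Notation ell2 := (ell2 S I).
Implicit Types x y z : ell2.

Variable W : weighted_map K I.

Lemma sqsum_weighted x (A : {fset I}) :
  sqsum S (fun i => weight W i * x (source W i)) A
    <= (absr S (weight_bound W) * hnorm x) ^+ 2.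
Proof.
apply: (@le_trans _ _ (absr S (weight_bound W) ^+ 2 *
    sqsum S x (source W @` A)%fset)); last first.
  by rewrite exprMn ler_wpM2l ?sqr_ge0// sqsum_le_hnorm.
rewrite /sqsum big_imfset/=; last by move=> i j _ _; exact: source_inj.
rewrite mulr_sumr; apply: ler_sum => i _; rewrite absrM exprMn.
rewrite ler_wpM2r ?sqr_ge0// ler_sqr ?nnegrE ?absr_ge0//.
rewrite -(ler_real_in S) -!normE.
apply: le_trans (weight_le W i) _; rewrite real_ler_norm// ger0_real//.
by rewrite (le_trans _ (weight_le W i)).
Qed.

Lemma weighted_subproof x :
  (fun i => weight W i * x (source W i)) \in square_summable S I.
Proof. by apply/asboolP; eexists; exact: sqsum_weighted. Qed.

Definition weighted_op x : ell2 := Ell2 (weighted_subproof x).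

Lemma weighted_op_linear : linear weighted_op.
Proof.
move=> a x y; apply: ell2P => i.
by rewrite ell2DE ell2ZE /= mulrDr !mulrA [_ * a]mulrC.
Qed.

HB.instance Definition _ :=
  GRing.isLinear.Build K ell2 ell2 *:%R weighted_op weighted_op_linear.

Lemma ler_norm_weighted x : `|weighted_op x| <= `|weight_bound W| * `|x|.
Proof.
rewrite (normE S) !ell2_normE -rmorphM ler_real_in.
apply: hnorm_le; first by rewrite mulr_ge0 ?absr_ge0 ?hnorm_ge0.
exact: sqsum_weighted.
Qed.

Lemma weighted_op_continuous : continuous weighted_op.
Proof.
apply: bounded_linear_continuous; apply/linear_boundedP.
exists `|weight_bound W|; split=> [|r Wr x]; first exact: normr_real.
by apply: le_trans (ler_norm_weighted x) _; rewrite ler_wpM2r// ltW.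
Qed.

End WeightedMaps.

Section Basis.
Context {R : realType} {K : numFieldType} {conj : K -> K}.
Variables (S : hilbert_scalars R conj) (I : choiceType).

Lemma sqsum_basis (i : I) A : sqsum S (fun j => (j == i)%:R) A <= 1.
Proof.
have one : absr S 1 = 1 by rewrite -(rmorph1 (real_in S)) absr_real_in.
have [iA|iA] := boolP (i \in A); last first.
  rewrite /sqsum big_seq big1// => j jA.
  rewrite (_ : (j == i) = false) ?absr0 ?expr0n//.
  by apply: contraNF iA => /eqP <-.
rewrite /sqsum (big_fsetD1 i)//= eqxx one expr1n big_seq big1 ?addr0// => j.
by rewrite !inE => /andP[/negPf-> _]; rewrite absr0 expr0n.
Qed.

Lemma basis_subproof (i : I) : (fun j => (j == i)%:R) \in square_summable S I.
Proof. by apply/asboolP; exists 1 => A; exact: sqsum_basis. Qed.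

Definition basis i : ell2 S I := Ell2 (basis_subproof i).

Lemma norm_basis i : `|basis i| <= 1.
Proof.
rewrite ell2_normE -(rmorph1 (real_in S)) ler_real_in; apply: hnorm_le => // A.
by rewrite expr1n; exact: sqsum_basis.
Qed.

Lemma weighted_op_basis (W : weighted_map K I) i :
  weighted_op W (basis (source W i)) = weight W i *: basis i.
Proof.
by apply: ell2P => j; rewrite ell2ZE /= (inj_eq (@source_inj _ _ W));
  have [->|] := eqVneq j i; rewrite ?mulr0.
Qed.

End Basis.

(** * Chains of a linear operator *)

Section Chains.
Context {K : numFieldType} {X : normedModType K}.
Variables (T : X -> X) (delta : K).

(** Existence of a delta-chain, in a form where concatenation of chains needs
no reindexing. *)
Inductive reach (f : X) : X -> Prop :=
| reach1 g of `|g - T f| < delta : reach f g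
| reachS h g of reach f h & `|g - T h| < delta : reach f g.

Lemma reach_trans f g h : reach f g -> reach g h -> reach f h.
Proof.
move=> fg; elim=> [k gk|k l _ fk kl]; [exact: reachS fg gk|exact: reachS fk kl].
Qed.

Lemma reach_orbit f (u : nat -> X) n : 0 < delta ->
  (forall k, (k < n)%N -> T (u k) = u k.+1) -> reach f (u 0%N) -> reach f (u n).
Proof.
move=> d0; elim: n => // n IHn Tu fu.
apply: (reachS (IHn _ fu)) => [k kn|]; first by apply: Tu; exact: ltnW.
by rewrite Tu// subrr normr0.
Qed.

Lemma reach_chain f g : reach f g ->
  exists m c, delta_chain setT T delta f g m c.
Proof.
elim=> [{}g fg|h {}g _ [m [c [m0 c0 cm _ cT]]] hg].
  exists 1%N, (fun l => if l is 0%N then f else g); split => //.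
  by move=> l /andP[]; case: l => [|[|]].
exists m.+1, (fun l => if (l <= m)%N then c l else g); split => //.
  by rewrite ltnn.
move=> l /andP[l1 lm]; have [lm'|lm'] := leqP l m.
  by rewrite (leq_trans (leq_pred l) lm'); apply: cT; rewrite l1.
have -> : l = m.+1 by apply/eqP; rewrite eqn_leq lm.
by rewrite /= leqnn cm.
Qed.
End Chains.

Section Criteria.
Context {K : numFieldType} {X : normedModType K}.
Variable T : {linear X -> X}.

Lemma CR_reach f : (forall delta, 0 < delta -> reach T delta f f) -> CR T f.
Proof. by move=> fr delta /fr/reach_chain. Qed.

Lemma CR0 : CR T 0.
Proof.
by apply: CR_reach => d d0; apply: reach1; rewrite linear0 subrr normr0.
Qed.

(** A bound P that each step of the chain improves to Q holds, improved, at the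
last vector, since a chain has at least one step.  If the chain returns to its
first vector, P f thus gives Q f. *)
Lemma delta_chain_last (Y : set X) (P Q : X -> Prop) delta f g m c :
  delta_chain Y T delta f g m c ->
  (forall x y, Y x -> P x -> `|y - T x| < delta -> Q y) ->
  (forall y, Q y -> P y) -> P f -> Q g.
Proof.
move=> [m0 c0 cm cY cT] PQ QP Pf; rewrite -cm -(prednK m0).
suff Qc l : (l < m)%N -> Q (c l.+1) by apply: Qc; rewrite prednK.
elim: l => [|l IHl] lm; apply: (PQ _ _ (cY _ (ltnW lm)) _ (cT _.+1 lm)).
  by rewrite c0.
by apply/QP/IHl/ltnW.
Qed.

(** For delta = |f| / 2 and |x| >= |f|, the next vector of the chain has norm
greater than 2 |x| - |f| / 2 > |f|. *)
Lemma CR_on_expansive (Y : set X) : Y 0 ->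
  (forall x, Y x -> 2 * `|x| <= `|T x|) -> CR_on Y T = [set 0].
Proof.
move=> Y0 Ye; apply/seteqP; split => [f fCR|_ ->]; last first.
  move=> d d0; exists 1%N, (fun=> 0); split => // l _.
  by rewrite linear0 subrr normr0.
apply: contrapT => /eqP f0; have f0' : 0 < `|f| by rewrite normr_gt0.
have d0 : 0 < `|f| / 2 by rewrite divr_gt0.
have [m [c fc]] := fCR _ d0.
suff : `|f| < `|f| by rewrite ltxx.
apply: (delta_chain_last (P := fun x => `|f| <= `|x|)
  (Q := fun x => `|f| < `|x|) fc) => //.
  move=> x y Yx fx xy; have : 2 * `|f| <= `|y| + `|y - T x|.
    apply: le_trans (_ : 2 * `|x| <= _); first by rewrite ler_pM2l.
    apply: le_trans (Ye _ Yx) _.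
    by rewrite -[X in `|X| <= _](subKr y); exact: ler_normB.
  move=> /le_lt_trans/(_ (ler_ltD (lexx _) xy)).
  have -> : 2 * `|f| = `|f| + `|f| / 2 + `|f| / 2 by field.
  rewrite ltrD2r; apply: le_lt_trans.
  by rewrite lerDl ltW.
by move=> y; exact: ltW.
Qed.

(** The coordinates of n + 1 vectors on n generators form a matrix with n + 1
rows and n columns, whose left kernel is a nontrivial linear relation. *)
Lemma not_finite_dimensional (Y : set X) (e : nat -> X) :
  (forall k, Y (e k)) ->
  (forall n (u : 'I_n -> K),
    \sum_(i < n) u i *: e i = 0 -> forall i, u i = 0) ->
  ~ finite_dimensional Y.
Proof.
move=> Ye ind [n [b [_ span]]].
have /choice[a aE] k := span (e k) (Ye k).
pose A : 'M[K]_(n.+1, n) := \matrix_(i, j) a i j.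
have : kermx A != 0.
  rewrite -mxrank_eq0 mxrank_ker subn_eq0 -ltnNge.
  exact: leq_ltn_trans (rank_leq_col A) _.
case/rowV0Pn => u /sub_kermxP uA /eqP[].
apply/rowP => i; rewrite mxE; apply: (ind _ (fun i => u 0 i)).
under eq_bigr => k _ do rewrite aE scaler_sumr.
rewrite exchange_big big1//= => j _.
under eq_bigr => k _ do rewrite scalerA.
rewrite -scaler_suml; have /rowP/(_ j) := uA; rewrite !mxE => uAj.
rewrite (_ : \sum_(k < n.+1) _ = 0) ?scale0r// -[RHS]uAj.
by apply: eq_bigr => k _; rewrite mxE.
Qed.

End Criteria.

(** * The operator *)

Lemma addz_succ (a : int) (n : nat) : a + n%:Z + 1 = a + n.+1%:Z.
Proof. by rewrite (intS n) [1 + _]addrC addrA. Qed.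

Definition site : choiceType := (int * option nat)%type.

Definition next_site (i : site) : site := (i.1 + 1, i.2).
Definition prev_site (i : site) : site := (i.1 - 1, i.2).

Lemma next_siteK : cancel next_site prev_site.
Proof. by case=> p r; rewrite /prev_site /= addrK. Qed.

Lemma prev_siteK : cancel prev_site next_site.
Proof. by case=> p r; rewrite /next_site /= subrK. Qed.

(** [cross] exchanges the site p of the main line with the site p of the hump
p.  Feeding the main line from the humps is then a weighted composition with an
involution, in particular with an injective map. *)
Definition cross (i : site) : site :=
  match i with
  | (Posz p, None) => (Posz p, Some p)
  | (Posz p, Some q) => if p == q then (Posz p, None) else i
  | _ => i
  end.

Lemma crossK : involutive cross.
Proof.
case=> -[p|p] [q|] //=; last by rewrite eqxx.
by case: eqVneq => [->|/negPf pq] //=; rewrite pq.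
Qed.

Section Operator.
Context {R : realType} {K : numFieldType} {conj : K -> K}.
Variable S : hilbert_scalars R conj.
Notation X := (ell2 S site).
Implicit Types x y : X.

(** The weight of the step that arrives at the site i. *)
Definition growth (i : site) : K :=
  if i.2 is Some q then if 0 < i.1 <= q%:Z then 4 else 4^-1 else 2.

(** The value 1/2 makes the total weight of the feeding 1, as [feed] is
followed by a step of weight 2 on the main line. *)
Definition feed_weight (i : site) : K :=
  if i is (Posz _, None) then 2^-1 else 0.

Lemma growth_neq0 i : growth i != 0.
Proof.
by case: i => p [q|]; rewrite /growth /=; [case: ifP|];
  rewrite ?invr_eq0 ?pnatr_eq0.
Qed.

Lemma growth_le i : `|growth i| <= 4.
Proof.
rewrite /growth; case: i.2 => [q|]; first case: ifP => _.
- by rewrite normr_nat.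
- by rewrite normfV normr_nat (le_trans (_ : _ <= 1)) ?invf_le1 ?ler1n ?ltr0n.
- by rewrite normr_nat ler_nat.
Qed.

Lemma growthV_le i : `|(growth i)^-1| <= 4.
Proof.
rewrite normfV /growth; case: i.2 => [q|]; first case: ifP => _.
- by rewrite normr_nat (le_trans (_ : _ <= 1)) ?invf_le1 ?ler1n ?ltr0n.
- by rewrite normfV normr_nat invrK.
- by rewrite normr_nat (le_trans (_ : _ <= 1)) ?invf_le1 ?ler1n ?ltr0n.
Qed.

Lemma half_le1 : (2^-1 : K) <= 1.
Proof. by rewrite invf_le1 ?ler1n ?ltr0n. Qed.

Lemma feed_weight_le i : `|feed_weight i| <= 1.
Proof.
by case: i => -[p|p] [q|] /=; rewrite ?normr0// normfV normr_nat half_le1.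
Qed.

Definition shift_map := WeightedMap (can_inj prev_siteK) growth_le.
Definition unshift_map :=
  WeightedMap (can_inj next_siteK) (fun i => growthV_le (next_site i)).
Definition feed_map := WeightedMap (inv_inj crossK) feed_weight_le.

Notation shift := (weighted_op shift_map : X -> X).
Notation unshift := (weighted_op unshift_map : X -> X).
Notation feed := (weighted_op feed_map : X -> X).

Lemma shiftK : cancel shift unshift.
Proof.
move=> x; apply: ell2P => i /=.
by rewrite mulKf ?growth_neq0// next_siteK.
Qed.

Lemma unshiftK : cancel unshift shift.
Proof.
by move=> x; apply: ell2P => i /=; rewrite prev_siteK mulVKf ?growth_neq0.
Qed.

(** [feed] reads humps only and writes on the main line only. *)
Lemma feed_feed x : feed (feed x) = 0.
Proof.
apply: ell2P => -[[p|p] [q|]] /=; rewrite ?mul0r// ?mulr0//.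
Qed.

Definition fed_shift x : X := shift (x + feed x).
Definition fed_shift_inv x : X := unshift x - feed (unshift x).

Lemma fed_shift_linear : linear fed_shift.
Proof.
move=> a x y; rewrite /fed_shift -linearP; congr (shift _).
by rewrite linearP scalerDr addrACA.
Qed.

HB.instance Definition _ :=
  GRing.isLinear.Build K X X *:%R fed_shift fed_shift_linear.

Lemma fed_shift_continuous : continuous fed_shift.
Proof.
move=> x; apply: (@continuous_comp X X X (fun x => x + feed x) shift x);
  last exact: weighted_op_continuous.
have feedc := weighted_op_continuous (S := S) (W := feed_map) (x := x).
exact: (@cvgD K X X (nbhs x) _ idfun feed x (feed x) cvg_id feedc).
Qed.

Lemma fed_shift_invertible : invertible_operator fed_shift.
Proof.
exists fed_shift_inv; split=> [x|x|].
- by rewrite /fed_shift_inv /fed_shift shiftK linearD/= feed_feed addr0 addrK.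
- rewrite /fed_shift_inv /fed_shift (_ : _ + _ = unshift x) ?unshiftK//.
  by rewrite linearB/= feed_feed subr0 subrK.
- move=> x.
  have unshiftc := weighted_op_continuous (S := S) (W := unshift_map) (x := x).
  have feedc :=
    weighted_op_continuous (S := S) (W := feed_map) (x := unshift x).
  apply: (@cvgB K X X (nbhs x) _ unshift (feed \o unshift) (unshift x)
    (feed (unshift x)) unshiftc).
  exact: (@continuous_comp X X X unshift feed x unshiftc feedc).
Qed.

Lemma fed_shiftE x p r : fed_shift x (p, r) = growth (p, r) *
  (x (p - 1, r) + feed_weight (p - 1, r) * x (cross (p - 1, r))).
Proof. by []. Qed.

Lemma fed_shift_hump x p q :
  fed_shift x (p, Some q) = growth (p, Some q) * x (p - 1, Some q).
Proof.
rewrite fed_shiftE (_ : feed_weight _ = 0) ?mul0r ?addr0//.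
by case: (p - 1).
Qed.

Definition main_line : set X := [set x | forall p q, x (p, Some q) = 0].

(** The weights of a left inverse of the operator on the main line, defined on
the whole space with norm at most 1/2: this is how the expansion by 2 is
obtained. *)
Definition main_map_weight (i : site) : K := if i.2 is Some _ then 0 else 2^-1.

Lemma main_map_weight_le i : `|main_map_weight i| <= 2^-1.
Proof.
rewrite /main_map_weight; case: i.2 => [_|]; rewrite ?normr0 ?invr_ge0 ?ler0n//.
by rewrite normfV normr_nat.
Qed.

Definition main_unshift := WeightedMap (can_inj next_siteK) main_map_weight_le.

Lemma fed_shift_expands x : main_line x -> 2 * `|x| <= `|fed_shift x|.
Proof.
move=> x0; have {1}-> : x = weighted_op main_unshift (fed_shift x).
  apply: ell2P => -[p [q|]]; first by rewrite x0 /= mul0r.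
  have -> : weighted_op main_unshift (fed_shift x) (p, None) =
      2^-1 * fed_shift x (p + 1, None) by [].
  rewrite fed_shiftE addrK.
  rewrite (_ : feed_weight (p, None) * x (cross (p, None)) = 0).
    by rewrite addr0 /growth /= mulKf// pnatr_eq0.
  by case: p => p /=; rewrite ?x0 ?mulr0 ?mul0r.
rewrite mulrC -ler_pdivlMr ?ltr0n// mulrC.
by apply: le_trans (ler_norm_weighted _ _) _; rewrite normfV normr_nat.
Qed.

(** The product of the factors 16 = 4 / (1/4) by which the growing steps up to p
exceed the decaying ones, inverted.  As the hump q has q growing steps only,
these weights are bounded below, though not uniformly in q. *)
Definition damping (q : nat) (p : int) : K :=
  if p is Posz n then 16^-1 ^+ minn n q else 1.

Lemma damping_gt0 q p : 0 < damping q p.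
Proof. by case: p => p //=; rewrite exprn_gt0// invr_gt0 ltr0n. Qed.

Lemma damping_le1 q p : damping q p <= 1.
Proof.
case: p => p //=; rewrite exprn_ile1// ?invr_ge0 ?ler0n//.
by rewrite invf_le1 ?ler1n ?ltr0n.
Qed.

Lemma damping_growth q p :
  damping q p * growth (p, Some q) = 4^-1 * damping q (p - 1).
Proof.
case: p => [[|n]|n].
- by rewrite /= min0n expr0 mul1r mulr1.
- rewrite (_ : Posz n.+1 - 1 = Posz n); last by rewrite -addn1 PoszD addrK.
  rewrite /growth /= lez_nat; case: ltnP => [nq|qn].
    rewrite (minn_idPl nq) exprS mulrAC; congr (_ * _).
    by field.
  by rewrite (minn_idPr (leqW qn)) mulrC.
- by rewrite /= !mul1r mulr1.
Qed.

Definition damped_le q (M : K) x :=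
  forall p, damping q p * `|x (p, Some q)| <= M.

Lemma damped_le_step q M d x y :
  damped_le q M x -> `|y - fed_shift x| < d -> damped_le q (4^-1 * M + d) y.
Proof.
move=> xM yx p.
have -> : y (p, Some q) =
    fed_shift x (p, Some q) + (y - fed_shift x) (p, Some q).
  by rewrite ell2DE ell2NE addrC subrK.
apply: (@le_trans _ _ (damping q p * (`|fed_shift x (p, Some q)| + d))).
  rewrite ler_pM2l ?damping_gt0// (le_trans (ler_normD _ _))// lerD2l.
  by apply/ltW; apply: le_lt_trans yx; exact: ler_norm_coord.
rewrite mulrDr; apply: lerD.
  rewrite fed_shift_hump normrM mulrA.
  rewrite -[X in X * `|_| * _](ger0_norm (ltW (damping_gt0 _ _))).
  rewrite -normrM damping_growth normrM -mulrA.
  rewrite normfV normr_nat ler_pM2l ?invr_gt0 ?ltr0n//.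
  rewrite ger0_norm ?(ltW (damping_gt0 _ _))//; exact: xM.
by rewrite ler_piMl ?damping_le1// (le_trans _ (ltW yx)).
Qed.

(** If M bounds the damped coordinates of x on the hump q, a chain from x to x
with delta = M / 4 shows that M / 4 + M / 4 = M / 2 also bounds them.
Iterating, they are 0. *)
Lemma CR_main_line x : CR fed_shift x -> main_line x.
Proof.
move=> xCR p q; apply: contrapT => /eqP x0.
have nx : 0 < `|x|.
  by apply: lt_le_trans (ler_norm_coord x (p, Some q)); rewrite normr_gt0.
have halve M : 0 < M -> damped_le q M x -> damped_le q (M * 2^-1) x.
  move=> M0 xM; have d0 : 0 < M * 4^-1 by rewrite mulr_gt0 ?invr_gt0 ?ltr0n.
  have [m [c xc]] := xCR _ d0.
  apply: (delta_chain_last (T := fed_shift) (P := damped_le q M)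
    (Q := damped_le q (M * 2^-1)) xc) => //.
    move=> y z _ yM yz; have := damped_le_step yM yz.
    by rewrite (_ : 4^-1 * M + M * 4^-1 = M * 2^-1)//; field.
  move=> y yM p'; apply: le_trans (yM p') _.
  by rewrite ler_piMr ?half_le1// ltW.
have small n : damped_le q (`|x| * 2^-1 ^+ n) x.
  elim: n => [|n IHn].
    move=> p'; rewrite expr0 mulr1 -[leRHS]mul1r.
    apply: ler_pM;
      by rewrite ?(ltW (damping_gt0 _ _)) ?damping_le1 ?ler_norm_coord.
  rewrite exprSr mulrA; apply: halve IHn.
  by rewrite mulr_gt0// exprn_gt0// invr_gt0 ltr0n.
have d0 : 0 < damping q p * `|x (p, Some q)|.
  by rewrite mulr_gt0 ?damping_gt0 ?normr_gt0.
have [n] := geometric_lt S (isT : (1 < 2)%N) (ltW nx) d0.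
by move=> /(le_lt_trans (small n p)); rewrite ltxx.
Qed.


Definition main_basis (p : int) : X := basis S ((p, None) : site).
Definition hump_basis (q : nat) (p : int) : X := basis S ((p, Some q) : site).

Lemma shift_basis i :
  shift (basis S i) = growth (next_site i) *: basis S (next_site i).
Proof. by rewrite -{1}(next_siteK i) (weighted_op_basis S shift_map). Qed.

Lemma feed_basis i :
  feed (basis S i) = feed_weight (cross i) *: basis S (cross i).
Proof. by rewrite -{1}(crossK i) (weighted_op_basis S feed_map). Qed.

Lemma fed_shift_main_basis p :
  fed_shift (main_basis p) = 2 *: main_basis (p + 1).
Proof.
rewrite /fed_shift feed_basis.
rewrite (_ : feed_weight _ = 0) ?scale0r ?addr0 ?shift_basis//.
by case: p.
Qed.

Lemma fed_shift_hump_basis q p : p != q%:Z ->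
  fed_shift (hump_basis q p) = growth (p + 1, Some q) *: hump_basis q (p + 1).
Proof.
move=> pq; rewrite /fed_shift feed_basis.
rewrite (_ : feed_weight _ = 0) ?scale0r ?addr0 ?shift_basis//.
by case: p pq => p //=; rewrite eqz_nat => /negPf->.
Qed.

Lemma growth_low (q : nat) (p : int) : 0 < p <= q%:Z -> growth (p, Some q) = 4.
Proof. by rewrite /growth /= => ->. Qed.

Lemma growth_high (q : nat) (p : int) : q%:Z < p -> growth (p, Some q) = 4^-1.
Proof. by rewrite /growth /= => qp; rewrite leNgt qp andbF. Qed.

(** At the top of the hump, the step feeds the main line. *)
Lemma fed_shift_hump_top (q : nat) :
  fed_shift (hump_basis q q) =
    4^-1 *: hump_basis q (q%:Z + 1) + main_basis (q%:Z + 1).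
Proof.
rewrite /fed_shift feed_basis /= eqxx /= linearD linearZ/= !shift_basis.
rewrite growth_high; last by rewrite ltrDl.
by rewrite /next_site /growth /= scalerA mulVf ?pnatr_eq0// scale1r.
Qed.

Lemma norm_hump_basis (a : K) q p : `|a *: hump_basis q p| <= `|a|.
Proof. by rewrite normrZ ler_piMr// norm_basis. Qed.

(** The chain first follows the orbit v of e_k - c g_k, where e and g are the
basis vectors of the main line and of the hump q = k + m.  The value
c = 2 2^-m is the one for which c 4^m, the size of the hump part at its top,
equals 2 2^m, the size of the main line part one step later.  The first step of
the chain is the only one with an error, of size 4 c; after the cancellation,
the chain follows the decaying orbit w on the hump, until one more jump
reaches 0. *)
Lemma main_basis_to0 (k : nat) d : 0 < d -> reach fed_shift d (main_basis k) 0.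
Proof.
move=> d0.
have [n nd] := geometric_lt S (isT : (1 < 2)%N) (ler0n K 4) d0.
pose m := n.+1; pose q := (k + m)%N; pose c : K := 2 * 2^-1 ^+ m.
have posS j : k%:Z + j%:Z + 1 = k%:Z + j.+1%:Z by exact: addz_succ.
pose v j := 2 ^+ j *: main_basis (k%:Z + j%:Z)
            - (c * 4 ^+ j) *: hump_basis q (k%:Z + j%:Z).
have fed_shift_low j : (j < m)%N ->
    fed_shift (hump_basis q (k%:Z + j%:Z)) = 4 *: hump_basis q (k%:Z + j.+1%:Z).
  move=> jm; rewrite fed_shift_hump_basis ?posS ?growth_low//.
    by rewrite -PoszD lez_nat leq_add2l jm ltz_nat addnS.
  by rewrite -PoszD eqz_nat eqn_add2l ltn_eqF.
have opv j : (j < m)%N -> fed_shift (v j) = v j.+1.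
  move=> jm; rewrite [fed_shift _](linearB fed_shift) !linearZ/=.
  rewrite fed_shift_main_basis fed_shift_low// posS.
  by rewrite scalerN !scalerA /v !exprSr mulrA.
have start : reach fed_shift d (main_basis k) (v 1%N).
  apply: reach1; rewrite -opv// -linearB.
  rewrite (_ : v 0%N - _ = - c *: hump_basis q (k%:Z + 0%:Z)); last first.
    by rewrite /v !expr0 scale1r mulr1 addr0 addrAC subrr add0r scaleNr.
  rewrite linearZ/= fed_shift_low// scalerA.
  apply: le_lt_trans (norm_hump_basis _ _ _) _.
  rewrite mulNr normrN normrM normr_nat ger0_norm; last first.
    by rewrite mulr_ge0// exprn_ge0// invr_ge0 ler0n.
  rewrite (_ : c * 4 = 4 * 2^-1 ^+ n)// /c exprS.
  by field.
have up : reach fed_shift d (main_basis k) (v m).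
  by apply: (@reach_orbit _ _ _ _ _ (fun j => v j.+1) n) => // j jn; exact: opv.
pose b : K := 2 * 2 ^+ m * 4^-1.
pose w i := - (b * 4^-1 ^+ i) *: hump_basis q (q%:Z + 1 + i%:Z).
have opvm : fed_shift (v m) = w 0%N.
  have cm : c * 4 ^+ m = 2 * 2 ^+ m.
    rewrite /c -mulrA; congr (2 * _).
    rewrite (_ : 4 = 2 * 2 :> K); last by rewrite -natrM.
    by rewrite exprMn mulrA -exprMn mulVf ?pnatr_eq0// expr1n mul1r.
  rewrite [fed_shift _](linearB fed_shift) !linearZ/= -PoszD -/q.
  rewrite fed_shift_main_basis fed_shift_hump_top cm.
  rewrite scalerN scalerDr !scalerA [2 ^+ m * 2]mulrC opprD addrCA subrr addr0.
  by rewrite /w /b expr0 mulr1 addr0 scaleNr.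
have opw i : fed_shift (w i) = w i.+1.
  have wS : q%:Z + 1 + i%:Z + 1 = q%:Z + 1 + i.+1%:Z by exact: addz_succ.
  rewrite /w linearZ/= fed_shift_hump_basis ?wS.
    rewrite growth_high; last by rewrite -addrA ltrDl.
    by rewrite scalerA mulNr -mulrA -exprSr.
  by rewrite -addrA -subr_eq0 addrAC subrr add0r.
have b0 : 0 <= b by rewrite /b !mulr_ge0 ?exprn_ge0 ?invr_ge0 ?ler0n.
have [N Nd] := geometric_lt S (isT : (1 < 4)%N) b0 d0.
apply: (@reachS _ _ _ _ _ (w N)).
  apply: (@reach_orbit _ _ _ _ _ w) => //.
  by apply: (reachS up); rewrite opvm subrr normr0.
rewrite sub0r normrN opw; apply: le_lt_trans (norm_hump_basis _ _ _) _.
rewrite normrN ger0_norm; last by rewrite mulr_ge0// exprn_ge0// invr_ge0 ler0n.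
apply: le_lt_trans Nd; apply: ler_wpM2l => //; rewrite exprS; apply: ler_piMl.
  by rewrite exprn_ge0// invr_ge0 ler0n.
by rewrite invf_le1 ?ler1n ?ltr0n.
Qed.

(** The orbit of 2^-N e_{k - N} reaches e_k in N steps. *)
Lemma main_basis_from0 (k : int) d :
  0 < d -> reach fed_shift d 0 (main_basis k).
Proof.
move=> d0.
have [N Nd] := geometric_lt S (isT : (1 < 2)%N) (ler01 : 0 <= 1 :> K) d0.
pose u i := (2^-1 ^+ N * 2 ^+ i) *: main_basis (k - N%:Z + i%:Z).
have -> : main_basis k = u N.
  by rewrite /u -exprMn mulVf ?pnatr_eq0// expr1n scale1r subrK.
apply: reach_orbit => // [i _|].
  rewrite /u linearZ/= fed_shift_main_basis scalerA -mulrA -exprSr.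
  by rewrite addz_succ.
apply: reach1; rewrite linear0 subr0; apply: le_lt_trans Nd.
rewrite normrZ mul1r expr0 mulr1.
by rewrite ger0_norm ?exprn_ge0 ?invr_ge0 ?ler0n// ler_piMr ?norm_basis.
Qed.

Lemma main_basis_CR (k : nat) : CR fed_shift (main_basis k).
Proof.
apply: CR_reach => d d0.
exact: reach_trans (main_basis_to0 k d0) (main_basis_from0 k d0).
Qed.

Lemma main_basis_free n (a : 'I_n -> K) :
  \sum_(i < n) a i *: main_basis i = 0 -> forall i, a i = 0.
Proof.
move=> a0 j; have coord (I : Type) (r : seq I) (P : pred I) (F : I -> X) i :
    (\sum_(l <- r | P l) F l) i = \sum_(l <- r | P l) F l i.
  by elim/big_rec2: _ => // l y x _ <-.
have := congr1 (fun x : X => x (Posz j, None)) a0; rewrite coord.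
have coef l : (a l *: main_basis l) (Posz j, None) = a l * (j == l)%:R.
  by rewrite ell2ZE /= xpair_eqE andbT eqz_nat.
rewrite (bigD1 j)// coef eqxx mulr1 big1 => [|l lj].
  by move=> /(etrans (esym (addr0 (a j)))).
by rewrite coef eq_sym (negPf lj) mulr0.
Qed.

End Operator.

Theorem theorem1p2 (R : realType) (K : numFieldType) (conj : K -> K)
    (hK : scalar_field R conj) :
  exists (X : completeNormedModType K) (T : {linear X -> X}),
    [/\ hilbert_norm conj X, continuous T & invertible_operator T] /\
    [/\ ~ chain_recurrent_on (CR T) T,
        ~ finite_dimensional (CR T)
      & CR_on (CR T) T = [set 0]].
Proof.
have [S] := hilbert_scalars_of hK.
exists (ell2 S site : completeNormedModType K),
  (fed_shift (S := S) : {linear _ -> _}).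
split; first split.
- exact: ell2_hilbert.
- exact: fed_shift_continuous.
- exact: fed_shift_invertible.
have CR_CR : CR_on (CR (fed_shift (S := S))) (fed_shift (S := S)) = [set 0].
  apply: CR_on_expansive; first exact: CR0.
  by move=> x /CR_main_line; exact: fed_shift_expands.
split => //.
- rewrite /chain_recurrent_on CR_CR => CR_trivial.
  have : CR (fed_shift (S := S)) (main_basis S 0) by exact: (main_basis_CR S 0).
  rewrite -CR_trivial => /(congr1 (fun x : ell2 S site => x (Posz 0, None))).
  by move=> one0; have /eqP : 1 = 0 :> K := one0; rewrite oner_eq0.
- apply: (not_finite_dimensional (e := fun k => main_basis S (Posz k))).
    exact: main_basis_CR.
  exact: main_basis_free.
Qed.
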